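(* If $(\mathcal{I},\|\cdot\|_{\mathcal{I}})$ is a Banach operator ideal (of bounded linear operators between Banach spaces), then $\mathcal{I}^{BLip\text{-}dual}$, with $\|\cdot\|_{\mathcal{I}^{BLip\text{-}dual}}$, is a Banach two-Lipschitz operator ideal.
   Context: Let $\mathbb{K}$ be $\mathbb{R}$ or $\mathbb{C}$; all Banach spaces are over $\mathbb{K}$. A pointed metric space is a metric space with a distinguished base point $0$. $Lip_0(X,Y)$ is the set of Lipschitz maps $T:X\to Y$ with $T(0)=0$, $Lip(T)$ is the least Lipschitz constant, and $X^{\#}=Lip_0(X,\mathbb{K})$. $\mathcal{L}(E,F)$ is the space of bounded linear operators. Banach operator ideals are in the usual sense of Pietsch. A map $T:X_1\times X_2\to E$ ($X_1,X_2$ pointed metric spaces, $E$ Banach) belongs to $BLip_0(X_1,X_2;E)$ if $T(x_1,0)=T(0,x_2)=0$ for all $x_1,x_2$ and there is $C>0$ with $\|T(x_1,x_2)-T(x_1,x_2')-T(x_1',x_2)+T(x_1',x_2')\|\le C\,d(x_1,x_1')d(x_2,x_2')$ for all $x_1,x_1'\in X_1$, $x_2,x_2'\in X_2$. The least such $C$ is $BLip(T)$; this is a Banach space norm on $BLip_0(X_1,X_2;E)$. A two-Lipschitz operator ideal $\mathcal{I}_{BLip}$ is a subclass of $BLip_0$ such that for all pointed metric spaces $X_1,X_2$ and Banach spaces $E$ the components $\mathcal{I}_{BLip}(X_1,X_2;E):=BLip_0(X_1,X_2;E)\cap\mathcal{I}_{BLip}$ satisfy: (i) $\mathcal{I}_{BLip}(X_1,X_2;E)$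 is a linear subspace of $BLip_0(X_1,X_2;E)$; (ii) for $f_1\in X_1^{\#}$, $f_2\in X_2^{\#}$, $e\in E$, the map $(x_1,x_2)\mapsto f_1(x_1)f_2(x_2)e$ belongs to $\mathcal{I}_{BLip}(X_1,X_2;E)$; (iii) if $f_1\in Lip_0(Z,X_1)$, $f_2\in Lip_0(W,X_2)$, $T\in\mathcal{I}_{BLip}(X_1,X_2;E)$ and $u\in\mathcal{L}(E,F)$, then $u\circ T\circ(f_1,f_2)\in\mathcal{I}_{BLip}(Z,W;F)$. It is a Banach two-Lipschitz operator ideal if there is $\|\cdot\|_{\mathcal{I}_{BLip}}:\mathcal{I}_{BLip}\to[0,\infty)$ such that (i') each $(\mathcal{I}_{BLip}(X_1,X_2;E),\|\cdot\|_{\mathcal{I}_{BLip}})$ is a Banach space and $BLip(T)\le\|T\|_{\mathcal{I}_{BLip}}$; (ii') $Id_{\mathbb{K}^2}:\mathbb{K}\times\mathbb{K}\to\mathbb{K}$, $(\alpha,\beta)\mapsto\alpha\beta$, has $\|Id_{\mathbb{K}^2}\|_{\mathcal{I}_{BLip}}=1$; (iii') in the situation of (iii), $\|u\circ T\circ(f_1,f_2)\|_{\mathcal{I}_{BLip}}\le\|u\|\,\|T\|_{\mathcal{I}_{BLip}}Lip(f_1)Lip(f_2)$. The transpose of $T\in BLip_0(X_1,X_2;E)$ is the bounded linear operator $T^t:E^*\to BLip_0(X_1,X_2;\mathbb{K})$, $T^t(e^* )=e^*\circ T$. The two-Lipschitz dual of $\mathcal{I}$ is $\mathcal{I}^{BLip\text{-}dual}(X_1,X_2;E)=\{T\in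 BLip_0(X_1,X_2;E): T^t\in\mathcal{I}(E^*,BLip_0(X_1,X_2;\mathbb{K}))\}$, with $\|T\|_{\mathcal{I}^{BLip\text{-}dual}}:=\|T^t\|_{\mathcal{I}}$. *)

(* Defs.v *)
From HB Require Import structures.
From mathcomp Require Import all_boot all_order all_algebra complex.
From mathcomp Require Import boolp classical_sets functions reals topology.
From mathcomp Require Import normedtype ring lra.

Set Implicit Arguments.
Unset Strict Implicit.
Unset Printing Implicit Defensive.

Import Order.TTheory GRing.Theory Num.Theory.
Import numFieldNormedType.Exports.

Local Open Scope classical_set_scope.
Local Open Scope ring_scope.
Local Open Scope complex_scope.

(* The common interface of the real and the complex numbers. Throughout,
   norms, distances and constants take their values in K itself, as in
   normedModType K and metricType K: they are elements c with 0 <= c, which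
   for K = R[i] means a real nonnegative number. *)
HB.mixin Record NumField_isScalarField K & Num.NumField K := {
  nneg_has_supremum : forall A : set K, A !=set0 ->
    (forall x, A x -> 0 <= x) -> has_ubound A -> supremums A !=set0 ;
  scalar_complete : forall F : set_system K^o,
    ProperFilter F -> cauchy F -> cvg F
}.

#[short(type="scalarFieldType")]
HB.structure Definition ScalarField :=
  {K of Num.NumField K & NumField_isScalarField K}.

Section real_scalars.
Variable R : realType.

Lemma real_nneg_has_supremum (A : set R) : A !=set0 ->
  (forall x, A x -> 0 <= x) -> has_ubound A -> supremums A !=set0.
Proof.
move=> A0 _ Aub; exists (sup A); split; first exact: sup_upper_bound.
by move=> y Ay; apply: ge_sup.
Qed.

HB.instance Definition _ :=
  NumField_isScalarField.Build R real_nneg_has_supremum (@R_complete R).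

End real_scalars.

Section complex_scalars.
Variable R : realType.

Lemma complex_nneg_has_supremum (A : set R[i]) : A !=set0 ->
  (forall x, A x -> 0 <= x) -> has_ubound A -> supremums A !=set0.
Proof.
move=> [a Aa] A_ge0 [b bA].
have AE x : A x -> x = (complex.Re x)%:C.
  by move=> /A_ge0; case: x => x y; rewrite lecE/= => /andP[/eqP->].
pose B := [set complex.Re x | x in A].
have B0 : B !=set0 by exists (complex.Re a), a.
have Bub : has_ubound B.
  exists (complex.Re b) => _ [x Ax <-].
  by have := bA _ Ax; rewrite lecE => /andP[].
exists (sup B)%:C; split=> [x Ax|y yA].
  rewrite (AE _ Ax) lecR; apply: sup_upper_bound; first by split.
  by exists x.
have := yA _ Aa; rewrite (AE _ Aa) lecE/= => /andP[y0 _].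
rewrite lecE/= y0 /=; apply: ge_sup => // _ [x Ax <-].
by have := yA _ Ax; rewrite lecE => /andP[].
Qed.

Lemma complex_complete (F : set_system R[i]^o) :
  ProperFilter F -> cauchy F -> cvg F.
Proof.
move=> FF /cauchyP F_cauchy.
have norm_lt (z : R[i]) (e : R) : `|z| < e%:C -> `|complex.Re z| < e /\ `|complex.Im z| < e.
  rewrite normc_def ltcR => ze; split; apply: le_lt_trans ze.
    by rewrite -sqrtr_sqr ler_wsqrtr // lerDl sqr_ge0.
  by rewrite -sqrtr_sqr ler_wsqrtr // lerDr sqr_ge0.
have Re_cvg : cvg (@complex.Re R @ F : set_system R^o).
  apply: (@R_complete R); apply/cauchyP => e e0.
  have [|z Fz] := F_cauchy e%:C; first by rewrite ltcR.
  exists (complex.Re z); rewrite /fmap /=; apply: filterS Fz => w.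
  by rewrite -!ball_normE /= => /norm_lt []; rewrite raddfB.
have Im_cvg : cvg (@complex.Im R @ F : set_system R^o).
  apply: (@R_complete R); apply/cauchyP => e e0.
  have [|z Fz] := F_cauchy e%:C; first by rewrite ltcR.
  exists (complex.Im z); rewrite /fmap /=; apply: filterS Fz => w.
  by rewrite -!ball_normE /= => /norm_lt [_]; rewrite raddfB.
move/cvg_ex : Re_cvg => [/= a Fa]; move/cvg_ex : Im_cvg => [/= b Fb].
apply/cvg_ex; exists (a +i* b); apply/cvgrPdist_lt => e.
rewrite ltcE /=; case: e => e e' /= /andP[/eqP -> e0].
have e20 : 0 < e / 2 by rewrite divr_gt0.
move/cvgrPdist_lt : Fa => /(_ _ e20) Fa.
move/cvgrPdist_lt : Fb => /(_ _ e20) Fb.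
near=> z.
have za : `|a - complex.Re z| < e / 2 by near: z.
have zb : `|b - complex.Im z| < e / 2 by near: z.
rewrite normc_def raddfB/= raddfB/= ltcR.
have -> : e = Num.sqrt (e ^+ 2) by rewrite sqrtr_sqr gtr0_norm.
rewrite ltr_sqrt ?exprn_gt0 //.
rewrite -(real_normK (num_real (a - complex.Re z))) -(real_normK (num_real (b - complex.Im z))).
apply: (@lt_le_trans _ _ ((e / 2) ^+ 2 + (e / 2) ^+ 2)).
  by rewrite ltrD // ltrXn2r // ?nnegrE ?normr_ge0 ?ltW.
by have := sqr_ge0 e; lra.
Unshelve. all: by end_near. Qed.

HB.instance Definition _ :=
  NumField_isScalarField.Build R[i] complex_nneg_has_supremum complex_complete.

End complex_scalars.

Variant scalar_kind := RealScalars | ComplexScalars.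

Definition scalar_field (R : realType) (s : scalar_kind) : scalarFieldType :=
  match s with
  | RealScalars => R : scalarFieldType
  | ComplexScalars => R[i] : scalarFieldType
  end.

#[short(type="pointedMetricType")]
HB.structure Definition PointedMetric (K : numDomainType) :=
  {X of Metric K X & isPointed X}.

(* K seen as the one-dimensional Banach space and, with base point 0 and
   distance `|x - y|, as a pointed metric space. *)
Section scalar_space.
Variable K : scalarFieldType.
#[non_forgetful_inheritance]
HB.instance Definition _ := NormedModule.copy K K^o.
#[non_forgetful_inheritance]
HB.instance Definition _ := Uniform_isComplete.Build K (@scalar_complete K).
#[non_forgetful_inheritance]
HB.instance Definition _ := Metric.copy K K^o.
End scalar_space.

(* The least constant c >= 0 such that a j <= c * b j for all j; it is
   attained as soon as such a constant exists, see least_boundP. *)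
Definition least_bound (K : numFieldType) (J : Type) (a b : J -> K) : K :=
  infimum 0 [set c | 0 <= c /\ forall j, a j <= c * b j].

Section least_bound.
Variables (K : scalarFieldType) (J : Type) (a b : J -> K).
Hypotheses (a_ge0 : forall j, 0 <= a j) (b_ge0 : forall j, 0 <= b j).
Variable c0 : K.
Hypothesis c0P : forall j, a j <= c0 * b j.

Let A := [set c : K | 0 <= c /\ forall j, a j <= c * b j].

Let norm_c0A : A `|c0|.
Proof.
split=> // j; rewrite -(ger0_norm (b_ge0 j)) -normrM ger0_norm //.
exact: le_trans (c0P j).
Qed.

Let infimums_A : infimums A !=set0.
Proof.
pose B := [set l : K | 0 <= l /\ lbound A l].
have [|x []//||s [sB s_least]] := @nneg_has_supremum K B.
- by exists 0; split=> // c [].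
- by exists `|c0| => l [_]; apply.
exists s; split=> [c Ac|l lA]; first by apply: s_least => l [_]; apply.
have l_real : l \is Num.real.
  by rewrite (ler_real (lA _ norm_c0A)) ger0_real.
have [l_ge0|l_lt0] := real_leP (real0 K) l_real.
- exact: sB.
by apply: le_trans (ltW l_lt0) _; apply: sB; split=> // c [].
Qed.

Lemma least_boundP : [/\ 0 <= least_bound a b,
  forall j, a j <= least_bound a b * b j &
  forall c, 0 <= c -> (forall j, a j <= c * b j) -> least_bound a b <= c].
Proof.
have [lbA glbA] : infimums A (least_bound a b).
  rewrite /least_bound /infimum ifF; last first.
    by apply/negbTE/set0P; exists `|c0|.
  by have [s sA] := infimums_A; apply: xgetPex; exists s.
split=> [|j|c c_ge0 cP]; [by apply: glbA => c []| |by apply: lbA].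
have [bj0|bj_neq0] := eqVneq (b j) 0.
  by have := c0P j; rewrite bj0 !mulr0.
have bj_gt0 : 0 < b j by rewrite lt_def bj_neq0 b_ge0.
by rewrite -ler_pdivrMr //; apply: glbA => c [_ cP]; rewrite ler_pdivrMr.
Qed.

End least_bound.

Lemma cvg_norm_le (K : numFieldType) (F : normedModType K) (T : Type)
    (G : set_system T) (f : T -> F) (l y : F) (c : K) :
  ProperFilter G -> f @ G --> l ->
  (\forall w \near G, `|f w - y| <= c) -> `|l - y| <= c.
Proof.
move=> GF /cvgrPdist_le fl fy; apply/ler_addgt0Pl => e e0.
have [w [/= wl wy]] := filter_ex (filterI (fl _ e0) fy).
by rewrite -(subrK (f w) l) -addrA (le_trans (ler_normD _ _)) // lerD.
Qed.

(* A normed space whose norm is the least constant c with `|D j v| <= c * b j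
   for all j, for F-valued additive maps D j, is complete provided bounded
   pointwise limits are again of the form D ^~ v. *)
Section least_bound_complete.
Variables (K : scalarFieldType) (V : normedModType K).
Variables (F : completeNormedModType K) (J : Type).
Variables (D : J -> V -> F) (b : J -> K).
Hypothesis b_ge0 : forall j, 0 <= b j.
Hypothesis D_sub : forall j u v, D j (u - v) = D j u - D j v.
Hypothesis D_le : forall j v, `|D j v| <= `|v| * b j.
Hypothesis norm_le : forall v c, 0 <= c ->
  (forall j, `|D j v| <= c * b j) -> `|v| <= c.
Hypothesis D_closed : forall (G : set_system V) (d : J -> F) c,
  ProperFilter G -> (forall j, D j @ G --> d j) ->
  (forall j, `|d j| <= c * b j) -> exists v, forall j, D j v = d j.

Lemma least_bound_complete (G : set_system V) :
  ProperFilter G -> cauchy G -> cvg G.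
Proof.
move=> GF /cauchyP G_cauchy.
have D_cvg j : cvg (D j @ G).
  apply: cauchy_cvg; apply/cauchyP => e e0.
  have bj1 : 0 < b j + 1 by rewrite ltr_wpDl.
  have [x Gx] := G_cauchy _ (divr_gt0 e0 bj1).
  exists (D j x); rewrite /fmap /=; apply: filterS Gx => w.
  rewrite -!ball_normE /= ltr_pdivlMr // => xw.
  rewrite -D_sub (le_lt_trans (D_le _ _)) //; apply: le_lt_trans xw.
  by rewrite ler_wpM2l // lerDl.
have [d Dd] : exists d : J -> F, forall j, D j @ G --> d j.
  by exists (fun j => lim (D j @ G)) => j; exact: D_cvg.
have [x0 Gx0] := G_cauchy 1 ltr01.
have [v vd] : exists v, forall j, D j v = d j.
  apply: (D_closed (G := G) (c := `|x0| + 1)) => // j; rewrite -[d j]subr0.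
  apply: (cvg_norm_le GF (Dd j)); apply: filterS Gx0 => w.
  rewrite -ball_normE /= => xw; rewrite subr0 (le_trans (D_le _ _)) //.
  rewrite ler_wpM2r // -(subrK x0 w) addrC (le_trans (ler_normD _ _)) //.
  by rewrite lerD2l distrC ltW.
apply/cvg_ex; exists v; apply/cvgrPdist_le => e e0.
have e20 : 0 < e / 2 by rewrite divr_gt0.
have [x Gx] := G_cauchy _ e20.
apply: filterS (Gx) => w; rewrite -ball_normE /= => xw.
apply: norm_le => [|j]; first exact: ltW.
rewrite D_sub vd; apply: (cvg_norm_le GF (Dd j)); apply: filterS Gx => w'.
rewrite -ball_normE /= => xw'; rewrite -D_sub (le_trans (D_le _ _)) //.
rewrite ler_wpM2r // (splitr e) -(subrK x w') -addrA (le_trans (ler_normD _ _)) //.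
by rewrite lerD // ltW // distrC.
Qed.

End least_bound_complete.

Section bounded_linear.
Variables (K : scalarFieldType) (E F : normedModType K).

Definition is_bounded_linear (f : E -> F) : Prop :=
  linear f /\ exists c : K, forall x, `|f x| <= c * `|x|.

Definition bounded_linear_pred : {pred E -> F} :=
  [pred f | `[< is_bounded_linear f >]].

Record bounded_linear := BoundedLinear {
  bounded_linear_fun :> E -> F ;
  bounded_linear_subproof : bounded_linear_fun \in bounded_linear_pred
}.

HB.instance Definition _ := [isSub for bounded_linear_fun].
HB.instance Definition _ := [Choice of bounded_linear by <:].

Lemma bounded_linearP (f : bounded_linear) : is_bounded_linear f.
Proof. by case: f => f /= /asboolP. Qed.

HB.instance Definition _ (f : bounded_linear) :=
  GRing.isLinear.Build K E F *:%R f (bounded_linearP f).1.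

Lemma bounded_linear_eq (f g : bounded_linear) : f =1 g -> f = g.
Proof. by move=> fg; apply: val_inj; apply/funext. Qed.

Lemma bounded_linear_submod_closed : subsemimod_closed bounded_linear_pred.
Proof.
split; first split.
- apply/asboolP; split=> [a x y|] /=; first by rewrite scaler0 addr0.
  by exists 0 => x; rewrite normr0 mul0r.
- move=> f g /asboolP[fl [cf fP]] /asboolP[gl [cg gP]]; apply/asboolP.
  split=> [a x y|] /=.
    rewrite !fctE fl gl scalerDr addrACA //.
  exists (cf + cg) => x; rewrite mulrDl.
  by apply: le_trans (ler_normD _ _) _; apply: lerD.
- move=> a f /asboolP[fl [cf fP]]; apply/asboolP.
  split=> [a' x y|] /=.
    by rewrite !fctE fl scalerDr !scalerA mulrC.
  exists (`|a| * cf) => x; rewrite -mulrA.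
  by rewrite fctE normrZ ler_wpM2l.
Qed.

HB.instance Definition _ :=
  GRing.SubChoice_isSubLmodule.Build K (E -> F) bounded_linear_pred
    bounded_linear bounded_linear_submod_closed.

Definition opnorm (f : bounded_linear) : K :=
  least_bound (fun x => `|f x|) (fun x => `|x|).

Lemma opnormP (f : bounded_linear) : [/\ 0 <= opnorm f,
  forall x, `|f x| <= opnorm f * `|x| &
  forall c, 0 <= c -> (forall x, `|f x| <= c * `|x|) -> opnorm f <= c].
Proof.
by have [_ [c fc]] := bounded_linearP f; apply: least_boundP fc => x.
Qed.

Lemma opnormD (f g : bounded_linear) : opnorm (f + g) <= opnorm f + opnorm g.
Proof.
have [f0 fP _] := opnormP f; have [g0 gP _] := opnormP g.
have [_ _ -> //] := opnormP (f + g); first exact: addr_ge0.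
move=> x; rewrite mulrDl.
by apply: le_trans (ler_normD _ _) _; apply: lerD.
Qed.

Let opnormZ_le a (f : bounded_linear) : opnorm (a *: f) <= `|a| * opnorm f.
Proof.
have [f0 fP _] := opnormP f.
have [_ _ -> //] := opnormP (a *: f); first exact: mulr_ge0.
by move=> x; rewrite -mulrA normrZ ler_wpM2l.
Qed.

Lemma opnormZ a (f : bounded_linear) : opnorm (a *: f) = `|a| * opnorm f.
Proof.
have [->|a0] := eqVneq a 0.
  apply/eqP; rewrite eq_le opnormZ_le normr0 mul0r /=.
  by have [] := opnormP (0 *: f).
apply/eqP; rewrite eq_le opnormZ_le -ler_pdivlMl ?normr_gt0 //=.
by rewrite -normfV -{1}[f](scalerK a0) opnormZ_le.
Qed.

Lemma opnorm0_eq0 (f : bounded_linear) : opnorm f = 0 -> f = 0.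
Proof.
move=> f0; apply: bounded_linear_eq => x; have [_ fP _] := opnormP f.
by apply/eqP; rewrite -normr_le0 (le_trans (fP x)) // f0 mul0r.
Qed.

HB.instance Definition _ :=
  Lmodule_isNormed.Build K bounded_linear opnormD opnormZ opnorm0_eq0.

End bounded_linear.

Section bounded_linear_complete.
Variables (K : scalarFieldType) (E : normedModType K).
Variables (F : completeNormedModType K).

Lemma bounded_linear_complete (G : set_system (bounded_linear E F)) :
  ProperFilter G -> cauchy G -> cvg G.
Proof.
apply: (@least_bound_complete K (bounded_linear E F) F E (fun x f => f x)
  (fun x => `|x|)) => //.
- by move=> x f; have [] := opnormP f.
- by move=> f c; have [_ _] := opnormP f; apply.
move=> {}G d c GF Gd dc.
have d_lin : linear d.
  move=> a x y; apply: (@norm_cvg_unique _ _ _ _ _ _ (Gd _)).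
  rewrite (_ : (fun f : bounded_linear E F => f (a *: x + y)) =
               (fun f : bounded_linear E F => a *: f x + f y)); last first.
    by apply/funext => f; have [-> _] := bounded_linearP f.
  by apply: cvgD; [apply: cvgZr; apply: Gd|apply: Gd].
have dP : d \in @bounded_linear_pred K E F.
  by apply/asboolP; split=> //; exists c.
by exists (BoundedLinear dP).
Qed.

HB.instance Definition _ :=
  Uniform_isComplete.Build (bounded_linear E F) bounded_linear_complete.

End bounded_linear_complete.

Section lipschitz.
Variables (K : numFieldType) (X Y : pointedMetricType K).

Record lip0 := Lip0 {
  lip0_fun :> X -> Y ;
  lip0_point : lip0_fun point = point ;
  lip0_bounded : exists2 C : K, 0 < C &
    forall x x', mdist (lip0_fun x) (lip0_fun x') <= C * mdist x x'
}.

Definition Lip (f : lip0) : K :=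
  least_bound (fun p : X * X => mdist (f p.1) (f p.2))
              (fun p : X * X => mdist p.1 p.2).

End lipschitz.

Definition second_difference (K : numFieldType) (X1 X2 : Type)
    (E : normedModType K) (T : X1 -> X2 -> E) (x1 x1' : X1) (x2 x2' : X2) : E :=
  T x1 x2 - T x1 x2' - T x1' x2 + T x1' x2'.

Section two_lipschitz.
Variables (K : scalarFieldType) (X1 X2 : pointedMetricType K).
Variable E : normedModType K.

Definition is_two_lipschitz (T : X1 -> X2 -> E) : Prop :=
  [/\ forall x1, T x1 point = 0, forall x2, T point x2 = 0 &
  exists2 C : K, 0 < C & forall x1 x1' x2 x2',
    `|second_difference T x1 x1' x2 x2'| <= C * mdist x1 x1' * mdist x2 x2'].

Definition two_lipschitz_pred : {pred X1 -> X2 -> E} :=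
  [pred T | `[< is_two_lipschitz T >]].

Record two_lipschitz := TwoLipschitz {
  two_lipschitz_fun :> X1 -> X2 -> E ;
  two_lipschitz_subproof : two_lipschitz_fun \in two_lipschitz_pred
}.

HB.instance Definition _ := [isSub for two_lipschitz_fun].
HB.instance Definition _ := [Choice of two_lipschitz by <:].

Lemma two_lipschitzP (T : two_lipschitz) : is_two_lipschitz T.
Proof. by case: T => T /= /asboolP. Qed.

Lemma two_lipschitz_eq (S T : two_lipschitz) : S =2 T -> S = T.
Proof. by move=> ST; apply: val_inj; apply/funext => x; apply/funext. Qed.

Lemma second_differenceD (S T : X1 -> X2 -> E) x1 x1' x2 x2' :
  second_difference (S + T) x1 x1' x2 x2' =
  second_difference S x1 x1' x2 x2' + second_difference T x1 x1' x2 x2'.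
Proof.
by rewrite /second_difference !fctE !opprD !addrA [LHS](ACl (1*3*5*7*2*4*6*8)).
Qed.

Lemma second_differenceZ a (T : X1 -> X2 -> E) x1 x1' x2 x2' :
  second_difference (a *: T) x1 x1' x2 x2' =
  a *: second_difference T x1 x1' x2 x2'.
Proof. by rewrite /second_difference !fctE !scalerDr !scalerN. Qed.

Lemma two_lipschitz_submod_closed : subsemimod_closed two_lipschitz_pred.
Proof.
split; first split.
- apply/asboolP; split=> //; exists 1 => // x1 x1' x2 x2'.
  rewrite [second_difference _ _ _ _ _](_ : _ = 0 - 0 - 0 + 0) //.
  by rewrite !subr0 addr0 normr0 !mulr_ge0 // mdist_ge0.
- move=> S T /asboolP[S1 S2 [c c0 Sc]] /asboolP[T1 T2 [d d0 Td]].
  apply/asboolP; split=> [x|x|]; rewrite ?fctE ?S1 ?S2 ?T1 ?T2 ?addr0 //.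
  exists (c + d); first exact: addr_gt0.
  move=> x1 x1' x2 x2'; rewrite second_differenceD !mulrDl.
  by apply: le_trans (ler_normD _ _) _; apply: lerD.
- move=> a T /asboolP[T1 T2 [c c0 Tc]].
  apply/asboolP; split=> [x|x|]; rewrite ?fctE ?T1 ?T2 ?scaler0 //.
  exists ((`|a| + 1) * c); first by rewrite mulr_gt0 // ltr_wpDl.
  move=> x1 x1' x2 x2'; rewrite second_differenceZ normrZ -!mulrA.
  apply: ler_pM => //; first by rewrite lerDl.
  by rewrite mulrA.
Qed.

HB.instance Definition _ :=
  GRing.SubChoice_isSubLmodule.Build K (X1 -> X2 -> E) two_lipschitz_pred
    two_lipschitz two_lipschitz_submod_closed.

Definition BLip (T : two_lipschitz) : K :=
  least_bound
    (fun p : (X1 * X1) * (X2 * X2) =>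
      `|second_difference T p.1.1 p.1.2 p.2.1 p.2.2|)
    (fun p : (X1 * X1) * (X2 * X2) => mdist p.1.1 p.1.2 * mdist p.2.1 p.2.2).

Lemma BLipP (T : two_lipschitz) : [/\ 0 <= BLip T,
  forall x1 x1' x2 x2', `|second_difference T x1 x1' x2 x2'| <=
    BLip T * (mdist x1 x1' * mdist x2 x2') &
  forall c, 0 <= c -> (forall x1 x1' x2 x2',
    `|second_difference T x1 x1' x2 x2'| <= c * (mdist x1 x1' * mdist x2 x2')) ->
    BLip T <= c].
Proof.
have [_ _ [c _ Tc]] := two_lipschitzP T.
have [|||T0 TP T_least] := @least_boundP K ((X1 * X1) * (X2 * X2))
  (fun p => `|second_difference T p.1.1 p.1.2 p.2.1 p.2.2|)
  (fun p => mdist p.1.1 p.1.2 * mdist p.2.1 p.2.2) _ _ c => //.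
- by move=> p; rewrite mulr_ge0 // mdist_ge0.
- by move=> p; rewrite mulrA.
split=> // [x1 x1' x2 x2'|d d0 Td].
  exact: (TP ((x1, x1'), (x2, x2'))).
by apply: T_least.
Qed.

Lemma BLipD (S T : two_lipschitz) : BLip (S + T) <= BLip S + BLip T.
Proof.
have [S0 SP _] := BLipP S; have [T0 TP _] := BLipP T.
have [_ _ -> //] := BLipP (S + T); first exact: addr_ge0.
move=> *; rewrite [second_difference _ _ _ _ _]second_differenceD mulrDl.
by apply: le_trans (ler_normD _ _) _; apply: lerD.
Qed.

Let BLipZ_le a (T : two_lipschitz) : BLip (a *: T) <= `|a| * BLip T.
Proof.
have [T0 TP _] := BLipP T.
have [_ _ -> //] := BLipP (a *: T); first exact: mulr_ge0.
move=> *; rewrite [second_difference _ _ _ _ _]second_differenceZ.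
by rewrite -mulrA normrZ ler_wpM2l.
Qed.

Lemma BLipZ a (T : two_lipschitz) : BLip (a *: T) = `|a| * BLip T.
Proof.
have [->|a0] := eqVneq a 0.
  apply/eqP; rewrite eq_le BLipZ_le normr0 mul0r /=.
  by have [] := BLipP (0 *: T).
apply/eqP; rewrite eq_le BLipZ_le -ler_pdivlMl ?normr_gt0 //=.
by rewrite -normfV -{1}[T](scalerK a0) BLipZ_le.
Qed.

Lemma second_difference_point (T : two_lipschitz) x1 x2 :
  second_difference T x1 point x2 point = T x1 x2.
Proof.
have [T1 T2 _] := two_lipschitzP T.
by rewrite /second_difference !T1 !T2 !subr0 addr0.
Qed.

Lemma BLip0_eq0 (T : two_lipschitz) : BLip T = 0 -> T = 0.
Proof.
move=> T0; apply: two_lipschitz_eq => x1 x2; have [_ TP _] := BLipP T.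
apply/eqP; rewrite -(second_difference_point T) -normr_le0.
by rewrite (le_trans (TP _ _ _ _)) // T0 mul0r.
Qed.

HB.instance Definition _ :=
  Lmodule_isNormed.Build K two_lipschitz BLipD BLipZ BLip0_eq0.

End two_lipschitz.

Section two_lipschitz_complete.
Variables (K : scalarFieldType) (X1 X2 : pointedMetricType K).
Variable E : completeNormedModType K.

Lemma two_lipschitz_complete (G : set_system (two_lipschitz X1 X2 E)) :
  ProperFilter G -> cauchy G -> cvg G.
Proof.
apply: (@least_bound_complete K (two_lipschitz X1 X2 E) E
  ((X1 * X1) * (X2 * X2))
  (fun p T => second_difference T p.1.1 p.1.2 p.2.1 p.2.2)
  (fun p => mdist p.1.1 p.1.2 * mdist p.2.1 p.2.2)).
- by move=> p; rewrite mulr_ge0 // mdist_ge0.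
- move=> p S T; rewrite -scaleN1r [LHS]second_differenceD.
  by rewrite [X in _ + X]second_differenceZ scaleN1r.
- by move=> p T; have [] := BLipP T.
- move=> T c c0 Tc; have [_ _ -> //] := BLipP T.
  by move=> x1 x1' x2 x2'; exact: (Tc ((x1, x1'), (x2, x2'))).
move=> {}G d c GF Gd dc.
pose T x1 x2 := d ((x1, point), (x2, point)).
have GT x1 x2 : (fun S : two_lipschitz X1 X2 E => S x1 x2) @ G --> T x1 x2.
  rewrite (_ : (fun _ => _) =
    (fun S : two_lipschitz X1 X2 E => second_difference S x1 point x2 point)).
    exact: (Gd ((x1, point), (x2, point))).
  by apply/funext => S; rewrite second_difference_point.
have Td p : second_difference T p.1.1 p.1.2 p.2.1 p.2.2 = d p.
  apply/esym; apply: (@norm_cvg_unique _ _ _ _ _ _ (Gd _)).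
  by apply: cvgD; [apply: cvgB; [apply: cvgB|]|]; apply: GT.
have TP : T \in @two_lipschitz_pred K X1 X2 E.
  apply/asboolP; split.
  - move=> x1; apply: (@norm_cvg_unique _ _ _ _ _ _ (GT _ _)).
    rewrite (_ : (fun _ => _) = fun=> 0); first exact: cvg_cst.
    by apply/funext => S; have [-> _] := two_lipschitzP S.
  - move=> x2; apply: (@norm_cvg_unique _ _ _ _ _ _ (GT _ _)).
    rewrite (_ : (fun _ => _) = fun=> 0); first exact: cvg_cst.
    by apply/funext => S; have [_ -> _] := two_lipschitzP S.
  exists (`|c| + 1) => [|x1 x1' x2 x2']; first by rewrite ltr_wpDl.
  rewrite (Td ((x1, x1'), (x2, x2'))) -mulrA.
  have := dc ((x1, x1'), (x2, x2')); move: (mdist_ge0 x1 x1') (mdist_ge0 x2 x2').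
  move=> /= m1 m2 dm.
  have m12 : 0 <= mdist x1 x1' * mdist x2 x2' by rewrite mulr_ge0.
  rewrite mulrDl mul1r ler_wpDr //.
  rewrite -[X in _ * X]ger0_norm // -normrM ger0_norm //.
  exact: le_trans dm.
by exists (TwoLipschitz TP).
Qed.

HB.instance Definition _ :=
  Uniform_isComplete.Build (two_lipschitz X1 X2 E) two_lipschitz_complete.

End two_lipschitz_complete.

(* In what follows bounded_linear E K is the dual space E^*, and lip0 X K is
   the Lipschitz dual X^#. *)
Section composition.
Variable K : scalarFieldType.

Section linear_maps.
Variables E F G : normedModType K.

Lemma id_subproof : id \in @bounded_linear_pred K E E.
Proof. by apply/asboolP; split=> //; exists 1 => x; rewrite mul1r. Qed.

Definition id_linear : bounded_linear E E := BoundedLinear id_subproof.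

Lemma comp_linear_subproof (u : bounded_linear F G) (v : bounded_linear E F) :
  u \o v \in @bounded_linear_pred K E G.
Proof.
have [u0 uP _] := opnormP u; have [v0 vP _] := opnormP v.
apply/asboolP; split=> [a x y|] /=; first by rewrite !linearP.
exists (opnorm u * opnorm v) => x; rewrite -mulrA.
by apply: le_trans (uP _) _; rewrite ler_wpM2l.
Qed.

Definition comp_linear u v : bounded_linear E G :=
  BoundedLinear (comp_linear_subproof u v).

End linear_maps.

Section two_lipschitz_maps.
Variables X1 X2 : pointedMetricType K.

Lemma post_comp_subproof (E F : normedModType K) (u : bounded_linear E F)
    (T : two_lipschitz X1 X2 E) :
  (fun x1 x2 => u (T x1 x2)) \in @two_lipschitz_pred K X1 X2 F.
Proof.
have [u0 uP _] := opnormP u.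
have [T1 T2 [c c0 Tc]] := two_lipschitzP T.
apply/asboolP; split=> [x1|x2|]; rewrite ?T1 ?T2 ?linear0 //.
exists ((opnorm u + 1) * c) => [|x1 x1' x2 x2'].
  by rewrite mulr_gt0 // ltr_wpDl.
rewrite /second_difference -!linearB -linearD -!mulrA.
apply: le_trans (uP _) _; apply: ler_pM => //; first by rewrite lerDl.
by rewrite mulrA; apply: Tc.
Qed.

Definition post_comp E F (u : bounded_linear E F) T : two_lipschitz X1 X2 F :=
  TwoLipschitz (post_comp_subproof u T).

Lemma pre_comp_subproof (Z W : pointedMetricType K) (E : normedModType K)
    (T : two_lipschitz X1 X2 E) (f1 : lip0 Z X1) (f2 : lip0 W X2) :
  (fun z w => T (f1 z) (f2 w)) \in @two_lipschitz_pred K Z W E.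
Proof.
have [T1 T2 [c c0 Tc]] := two_lipschitzP T.
have [b1 b10 f1P] := lip0_bounded f1; have [b2 b20 f2P] := lip0_bounded f2.
apply/asboolP; split=> [z|w|]; rewrite ?lip0_point ?T1 ?T2 //.
exists (c * (b1 * b2)) => [|z z' w w']; first by rewrite !mulr_gt0.
apply: le_trans (Tc _ _ _ _) _; rewrite -!mulrA.
apply: ler_wpM2l; first exact: ltW.
by rewrite (mulrCA b2) (mulrA b1); apply: ler_pM; rewrite ?mdist_ge0.
Qed.

Definition pre_comp Z W E (T : two_lipschitz X1 X2 E) f1 f2 :
  two_lipschitz Z W E := TwoLipschitz (pre_comp_subproof T f1 f2).

Lemma rank_one_subproof (E : normedModType K) (f1 : lip0 X1 K)
    (f2 : lip0 X2 K) (e : E) :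
  (fun x1 x2 => (f1 x1 * f2 x2) *: e) \in @two_lipschitz_pred K X1 X2 E.
Proof.
have [b1 b10 f1P] := lip0_bounded f1; have [b2 b20 f2P] := lip0_bounded f2.
apply/asboolP; split=> [x1|x2|].
- by rewrite [f2 point]lip0_point mulr0 scale0r.
- by rewrite [f1 point]lip0_point mul0r scale0r.
exists (b1 * b2 * (`|e| + 1)) => [|x1 x1' x2 x2'].
  by rewrite !mulr_gt0 // ltr_wpDl.
rewrite /second_difference -!scalerBl -!scalerDl normrZ.
have -> : f1 x1 * f2 x2 - f1 x1 * f2 x2' - f1 x1' * f2 x2 + f1 x1' * f2 x2' =
  (f1 x1' - f1 x1) * (f2 x2' - f2 x2) by ring.
have := f1P x1 x1'; have := f2P x2 x2'; rewrite /mdist /= => f2x f1x.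
set m1 := mdist x1 x1'; set m2 := mdist x2 x2'.
have -> : b1 * b2 * (`|e| + 1) * m1 * m2 = (b1 * m1) * (b2 * m2) * (`|e| + 1).
  by ring.
by rewrite normrM; apply: ler_pM; rewrite ?mulr_ge0 ?ler_pM // lerDl.
Qed.

Definition rank_one (E : normedModType K) (f1 : lip0 X1 K) (f2 : lip0 X2 K)
    (e : E) : two_lipschitz X1 X2 E :=
  TwoLipschitz (rank_one_subproof f1 f2 e).

End two_lipschitz_maps.

Lemma mul_subproof :
  (fun a b : K => a * b) \in @two_lipschitz_pred K K K K.
Proof.
apply/asboolP; split=> [a|a|]; [exact: mulr0|exact: mul0r|].
exists 1 => // a a' b b'; rewrite mul1r.
have -> : second_difference (fun a b : K => a * b) a a' b b' =
  (a' - a) * (b' - b) by rewrite /second_difference; ring.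
by rewrite normrM.
Qed.

Definition mul_two_lipschitz : two_lipschitz K K K := TwoLipschitz mul_subproof.

End composition.

Section transpose.
Variables (K : scalarFieldType) (X1 X2 : pointedMetricType K).
Variables (E : normedModType K) (T : two_lipschitz X1 X2 E).

Lemma transpose_subproof :
  (fun f : bounded_linear E K => post_comp f T)
    \in @bounded_linear_pred K (bounded_linear E K) (two_lipschitz X1 X2 K).
Proof.
apply/asboolP; split=> [a f g|]; first by apply: two_lipschitz_eq.
exists (BLip T) => f; have [T0 TP _] := BLipP T.
have [_ _ -> //] := BLipP (post_comp f T) => [|x1 x1' x2 x2'].
  by rewrite mulr_ge0.
rewrite /second_difference /= -!linearB -linearD.
have [f0 fP _] := opnormP f; apply: le_trans (fP _) _.
rewrite -[`|f|]/(opnorm f) [BLip T * _]mulrC -mulrA.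
by apply: ler_wpM2l => //; apply: TP.
Qed.

Definition transpose :
    bounded_linear (bounded_linear E K) (two_lipschitz X1 X2 K) :=
  BoundedLinear transpose_subproof.

End transpose.

Definition is_subspace (K : numFieldType) (V : lmodType K) (S : set V) : Prop :=
  S 0 /\ forall a u v, S u -> S v -> S (a *: u + v).

(* The subspace S, with norm n, is a Banach space; n is only relevant on S. *)
Record is_banach_for (K : numFieldType) (V : lmodType K) (S : set V)
    (n : V -> K) : Prop := {
  banach_norm_ge0 : forall u, S u -> 0 <= n u ;
  banach_norm0_eq0 : forall u, S u -> n u = 0 -> u = 0 ;
  banach_normZ : forall a u, S u -> n (a *: u) = `|a| * n u ;
  banach_normD : forall u v, S u -> S v -> n (u + v) <= n u + n v ;
  banach_complete : forall u : nat -> V, (forall k, S (u k)) ->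
    (forall e, 0 < e ->
      exists N, forall p q, (N <= p)%N -> (N <= q)%N -> n (u p - u q) < e) ->
    exists2 v, S v &
      forall e, 0 < e -> exists N, forall p, (N <= p)%N -> n (u p - v) < e
}.

Definition operator_class (K : scalarFieldType) :=
  forall E F : completeNormedModType K, set (bounded_linear E F).

Definition operator_class_norm (K : scalarFieldType) :=
  forall E F : completeNormedModType K, bounded_linear E F -> K.

(* Pietsch's axioms. All finite rank operators belong to I: x |-> f x *: y is
   the composite of f, of the identity of K and of a |-> a *: y. *)
Record operator_ideal (K : scalarFieldType) (I : operator_class K) : Prop := {
  operator_ideal_subspace : forall E F, is_subspace (I E F) ;
  operator_ideal_id : I K K (id_linear K) ;
  operator_ideal_comp : forall (E0 E F F0 : completeNormedModType K)
      (w : bounded_linear F F0) (T : bounded_linear E F)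
      (v : bounded_linear E0 E),
    I E F T -> I E0 F0 (comp_linear w (comp_linear T v))
}.

Record banach_operator_ideal (K : scalarFieldType) (I : operator_class K)
    (nI : operator_class_norm K) : Prop := {
  banach_operator_ideal_ideal : operator_ideal I ;
  banach_operator_ideal_banach : forall E F, is_banach_for (I E F) (nI E F) ;
  banach_operator_ideal_id : nI K K (id_linear K) = 1 ;
  banach_operator_ideal_comp : forall (E0 E F F0 : completeNormedModType K)
      (w : bounded_linear F F0) (T : bounded_linear E F)
      (v : bounded_linear E0 E),
    I E F T ->
    nI E0 F0 (comp_linear w (comp_linear T v)) <= `|w| * nI E F T * `|v|
}.

Definition two_lipschitz_class (K : scalarFieldType) :=
  forall (X1 X2 : pointedMetricType K) (E : completeNormedModType K),
    set (two_lipschitz X1 X2 E).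

Definition two_lipschitz_class_norm (K : scalarFieldType) :=
  forall (X1 X2 : pointedMetricType K) (E : completeNormedModType K),
    two_lipschitz X1 X2 E -> K.

(* post_comp u (pre_comp T f1 f2) is the map u o T o (f1, f2). *)
Record two_lipschitz_ideal (K : scalarFieldType) (I : two_lipschitz_class K) :
    Prop := {
  two_lipschitz_ideal_subspace : forall X1 X2 E, is_subspace (I X1 X2 E) ;
  two_lipschitz_ideal_rank_one : forall (X1 X2 : pointedMetricType K)
      (E : completeNormedModType K) (f1 : lip0 X1 K) (f2 : lip0 X2 K) (e : E),
    I X1 X2 E (rank_one f1 f2 e) ;
  two_lipschitz_ideal_comp : forall (Z W X1 X2 : pointedMetricType K)
      (E F : completeNormedModType K) (f1 : lip0 Z X1) (f2 : lip0 W X2)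
      (T : two_lipschitz X1 X2 E) (u : bounded_linear E F),
    I X1 X2 E T -> I Z W F (post_comp u (pre_comp T f1 f2))
}.

Record banach_two_lipschitz_ideal (K : scalarFieldType)
    (I : two_lipschitz_class K) (nI : two_lipschitz_class_norm K) : Prop := {
  banach_two_lipschitz_ideal_ideal : two_lipschitz_ideal I ;
  banach_two_lipschitz_ideal_banach : forall X1 X2 E,
    is_banach_for (I X1 X2 E) (nI X1 X2 E) ;
  banach_two_lipschitz_ideal_BLip : forall (X1 X2 : pointedMetricType K)
      (E : completeNormedModType K) (T : two_lipschitz X1 X2 E),
    I X1 X2 E T -> BLip T <= nI X1 X2 E T ;
  banach_two_lipschitz_ideal_id : nI K K K (mul_two_lipschitz K) = 1 ;
  banach_two_lipschitz_ideal_comp : forall (Z W X1 X2 : pointedMetricType K)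
      (E F : completeNormedModType K) (f1 : lip0 Z X1) (f2 : lip0 W X2)
      (T : two_lipschitz X1 X2 E) (u : bounded_linear E F),
    I X1 X2 E T ->
    nI Z W F (post_comp u (pre_comp T f1 f2)) <=
      `|u| * nI X1 X2 E T * Lip f1 * Lip f2
}.

Section two_lipschitz_dual.
Variable K : scalarFieldType.

Definition BLip_dual (I : operator_class K) : two_lipschitz_class K :=
  fun X1 X2 E =>
    [set T | I (bounded_linear E K) (two_lipschitz X1 X2 K) (transpose T)].

Definition BLip_dual_norm (nI : operator_class_norm K) :
    two_lipschitz_class_norm K :=
  fun X1 X2 E T =>
    nI (bounded_linear E K) (two_lipschitz X1 X2 K) (transpose T).

End two_lipschitz_dual.

(* Main.v *)
Require Import Defs.
From HB Require Import structures.
From mathcomp Require Import all_boot all_order all_algebra complex.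
From mathcomp Require Import boolp classical_sets reals topology.
From mathcomp Require Import normedtype ring lra.

Set Implicit Arguments.
Unset Strict Implicit.
Unset Printing Implicit Defensive.

Import Order.TTheory GRing.Theory Num.Theory.
Import numFieldNormedType.Exports.

Local Open Scope classical_set_scope.
Local Open Scope ring_scope.

(** Write T^t for the transpose of T. Every axiom about T is the corresponding
    axiom of the operator ideal I, transported along T |-> T^t.

    - Transposition is linear and turns composites around: the transpose of
      u o T o (f1, f2) is P o T^t o v, where P precomposes two-Lipschitz forms
      with (f1, f2), so that |P| <= Lip f1 * Lip f2, and v precomposes
      functionals with u, so that |v| <= |u| (transpose_comp). The ideal
      property and its norm inequality follow.
    - The transposes of the rank-one maps factor through the identity of K
      (transpose_rank_one). For the product K x K -> K the identity of K also
      factors through the transpose, all factors being contractions; both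
      inequalities together make its dual norm equal to 1
      (transpose_mul_factor, id_factor_transpose_mul).
    - Transposition is isometric from BLip to the operator norm
      (norm_transpose), and the norm of a Banach operator ideal dominates the
      operator norm (ideal_norm_ge_opnorm). Hence BLip T <= |T|_dual.
    - A sequence of maps T_k that is Cauchy for the dual norm is then Cauchy for
      BLip and has a BLip-limit T, while the transposes of the T_k have a limit
      S in the ideal I. Both limits are limits in operator norm, so S = T^t, and
      T is the limit for the dual norm.

    The two norm comparisons of the third point need, for each vector x of a
    normed space, a functional f with |f| <= 1 and |f x| >= |x|. This is the
    Hahn-Banach theorem, proved here for a sublinear functional p on a real
    vector space: by Zorn's lemma there are minimal sublinear functionals below
    p, and a minimal one is linear. The complex case follows by applying the
    theorem to the underlying real space and passing from the real functional f
    to x |-> f x - i f (i x). *)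

(** * Sublinear functionals and the Hahn-Banach theorem *)

Section sublinear.
Variables (R : realType) (V : lmodType R).
Implicit Types (q : V -> R) (x y : V).

(** The second condition amounts to positive homogeneity, see sublinearZ; the
    inequality is what passes to infima. *)
Definition sublinear q : Prop :=
  (forall x y, q (x + y) <= q x + q y) /\
  (forall c x, 0 <= c -> q (c *: x) <= c * q x).

Lemma sublinear0 q : sublinear q -> q 0 = 0.
Proof.
move=> [qD qZ]; apply/eqP; rewrite eq_le; apply/andP; split.
  by have := qZ 0 0 (lexx 0); rewrite scale0r mul0r.
by have := qD 0 0; rewrite addr0 lerDl.
Qed.

Lemma sublinearZ q c x : sublinear q -> 0 <= c -> q (c *: x) = c * q x.
Proof.
move=> q_sub; rewrite le_eqVlt => /orP[/eqP<-|c0].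
  by rewrite scale0r mul0r sublinear0.
have [_ qZ] := q_sub; apply/eqP; rewrite eq_le qZ ?(ltW c0) //=.
rewrite -ler_pdivlMl //; have := qZ c^-1 (c *: x).
by rewrite scalerA mulVf ?gt_eqF // scale1r => -> //; rewrite invr_ge0 ltW.
Qed.

Lemma sublinear_geN q x : sublinear q -> - q (- x) <= q x.
Proof.
move=> q_sub; have [qD _] := q_sub; have := qD x (- x).
by rewrite subrr sublinear0 // -lerBlDr sub0r.
Qed.

Section infimum.
Variables (J : Type) (A : set J) (g : J -> V -> R) (l : V -> R).
Hypotheses (A0 : A !=set0) (gl : forall j x, A j -> l x <= g j x).

Definition pointwise_inf x := inf [set g j x | j in A].

Lemma pointwise_inf_le j x : A j -> pointwise_inf x <= g j x.
Proof.
move=> Aj; apply: ge_inf; last by exists j.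
by exists (l x) => _ [k Ak <-]; exact: gl.
Qed.

Lemma pointwise_inf_ge c x :
  (forall j, A j -> c <= g j x) -> c <= pointwise_inf x.
Proof.
move=> cg; apply: lb_le_inf; first by have [j Aj] := A0; exists (g j x), j.
by move=> _ [j Aj <-]; exact: cg.
Qed.

(** Infima of sublinear functionals are rarely subadditive; they are if the
    values at x and at y of two members of the family are jointly controlled
    by a single member. This covers both chains and the family that defines
    lower_along. *)
Lemma sublinear_pointwise_inf :
  (forall i j x y, A i -> A j ->
    exists2 k, A k & g k (x + y) <= g i x + g j y) ->
  (forall j c x, A j -> 0 <= c -> exists2 k, A k & g k (c *: x) <= c * g j x) ->
  sublinear pointwise_inf.
Proof.
move=> gD gZ; split=> [x y|c x].
  rewrite -lerBlDr; apply: pointwise_inf_ge => i Ai.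
  rewrite lerBlDr -lerBlDl; apply: pointwise_inf_ge => j Aj; rewrite lerBlDl.
  have [k Ak] := gD i j x y Ai Aj; apply: le_trans; exact: pointwise_inf_le.
rewrite le_eqVlt => /orP[/eqP<-|c0].
  have [j Aj] := A0; have [k Ak] := gZ j 0 x Aj (lexx 0).
  by rewrite !mul0r; apply: le_trans; exact: pointwise_inf_le.
rewrite -ler_pdivrMl //; apply: pointwise_inf_ge => j Aj.
rewrite ler_pdivrMl //; have [k Ak] := gZ j c x Aj (ltW c0).
by apply: le_trans; exact: pointwise_inf_le.
Qed.

End infimum.

(** A sublinear functional below q whose value at - y is at most - q y, hence as
    small as if q were linear: this is what makes minimal functionals odd. *)
Definition lower_along q y : V -> R :=
  pointwise_inf [set t : R | 0 <= t] (fun t x => q (x + t *: y) - t * q y).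

Section lower_along.
Variables (q : V -> R) (y : V).
Hypothesis q_sub : sublinear q.

Let lower_lbound (t : R) x : [set t : R | 0 <= t] t ->
  - q (- x) <= q (x + t *: y) - t * q y.
Proof.
move=> /= t0; have [qD _] := q_sub; rewrite -(sublinearZ y q_sub t0).
have := qD (x + t *: y) (- x); rewrite addrAC subrr add0r; lra.
Qed.

Let nneg0 : [set t : R | 0 <= t] !=set0. Proof. by exists 0 => /=. Qed.

Lemma sublinear_lower_along : sublinear (lower_along q y).
Proof.
have [qD qZ] := q_sub.
apply: (sublinear_pointwise_inf nneg0 lower_lbound).
- move=> s t x x' /= s0 t0; exists (s + t); first exact: addr_ge0.
  have := qD (x + s *: y) (x' + t *: y); rewrite scalerDl addrACA; lra.
- move=> t c x /= t0 c0; exists (c * t); first exact: mulr_ge0.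
  have := qZ c (x + t *: y) c0; rewrite scalerDr scalerA; lra.
Qed.

(** The term t = 0 of the infimum. *)
Lemma lower_along_le x : lower_along q y x <= q x.
Proof.
have := pointwise_inf_le lower_lbound x (lexx 0).
by rewrite scale0r addr0 mul0r subr0.
Qed.

(** The term t = 1 of the infimum. *)
Lemma lower_along_opp : lower_along q y (- y) <= - q y.
Proof.
have := pointwise_inf_le lower_lbound (- y) ler01.
by rewrite scale1r addNr sublinear0 // sub0r mul1r.
Qed.

End lower_along.

(** Zorn's lemma: the functionals of a chain are bounded below at x by
    - p (- x), so their pointwise infimum is finite, and it is sublinear
    because two members of a chain are comparable. *)
Lemma exists_minimal_sublinear p : sublinear p -> exists q,
  [/\ sublinear q, forall x, q x <= p x &
    forall r, sublinear r -> (forall x, r x <= q x) -> r = q].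
Proof.
move=> p_sub; pose T := {q : V -> R | sublinear q /\ forall x, q x <= p x}.
pose above (q r : T) : bool := `[< forall x, sval r x <= sval q x >].
have [| | | |[q [q_sub qp]] q_min] := @Zorn T above.
- by move=> q; apply/asboolP.
- move=> q r s /asboolP rq /asboolP sr; apply/asboolP => x.
  exact: le_trans (sr x) (rq x).
- move=> [q qP] [r rP] /asboolP /= rq /asboolP /= qr.
  apply: eq_exist => /=; apply/funext => x; apply/eqP.
  by rewrite eq_le rq qr.
- move=> A A_tot; have [[q0 Aq0]|A0] := pselect (A !=set0); last first.
    by exists (exist _ p (conj p_sub (fun=> lexx _))) => s As; case: A0;
       exists s.
  have A_lb (q : T) x : A q -> - p (- x) <= sval q x.
    case: q => q [q_sub qp] _ /=; apply: le_trans (sublinear_geN x q_sub).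
    by rewrite lerN2.
  have A0 : A !=set0 by exists q0.
  pose r := pointwise_inf A (fun q : T => sval q).
  have r_sub : sublinear r.
    apply: (sublinear_pointwise_inf A0 A_lb).
      move=> q1 q2 x y A1 A2.
      have [/asboolP q21|/asboolP q12] := A_tot _ _ A1 A2.
        exists q2 => //; case: (svalP q2) => -[qD _] _.
        by rewrite (le_trans (qD x y)) // lerD2r.
      exists q1 => //; case: (svalP q1) => -[qD _] _.
      by rewrite (le_trans (qD x y)) // lerD2l.
    move=> q c x Aq c0; exists q => //; case: (svalP q) => -[_ qZ] _.
    exact: qZ.
  have rp x : r x <= p x.
    have [_ q0p] := svalP q0; apply: le_trans (q0p x).
    exact: (pointwise_inf_le A_lb).
  exists (exist _ r (conj r_sub rp)) => q Aq; apply/asboolP => x /=.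
  exact: (pointwise_inf_le A_lb).
exists q; split=> // r r_sub rq.
have rp x : r x <= p x by apply: le_trans (rq x) (qp x).
have := q_min (exist _ r (conj r_sub rp)).
by move=> /(_ _)/(congr1 sval) /=; apply; apply/asboolP.
Qed.

(** Any functional f minimal below lower_along p x0 will do. Replacing f by
    lower_along f y leaves it unchanged, whence f (- y) <= - f y: f is odd, and
    an odd sublinear functional is linear. Moreover
    - f x0 = f (- x0) <= lower_along p x0 (- x0) <= - p x0. *)
Lemma hahn_banach_sublinear p x0 : sublinear p ->
  exists f : V -> R, [/\ linear_for *%R f, forall x, f x <= p x & f x0 = p x0].
Proof.
move=> p_sub; have q0_sub := sublinear_lower_along x0 p_sub.
have [f [f_sub f_le f_min]] := exists_minimal_sublinear q0_sub.
have f_opp y : f (- y) = - f y.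
  apply/eqP; rewrite eq_le; apply/andP; split; last first.
    by have := sublinear_geN (- y) f_sub; rewrite opprK.
  rewrite -[X in X (- y) <= _](f_min (lower_along f y)) //.
  - exact: lower_along_opp.
  - exact: sublinear_lower_along.
  - exact: lower_along_le.
have [fD _] := f_sub.
exists f; split.
- have fD' x y : f (x + y) = f x + f y.
    apply/eqP; rewrite eq_le fD /= -lerN2 opprD -!f_opp opprD; exact: fD.
  move=> c x y; rewrite fD'; congr (_ + _).
  have [c0|c0] := leP 0 c; first exact: sublinearZ.
  rewrite -[c]opprK scaleNr f_opp sublinearZ ?mulNr //.
  by rewrite oppr_ge0 ltW.
- by move=> x; apply: le_trans (f_le x) (lower_along_le _ p_sub x).
- apply/eqP; rewrite eq_le (le_trans (f_le x0)) ?lower_along_le //=.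
  rewrite -lerN2 -f_opp; apply: le_trans (f_le _) _; exact: lower_along_opp.
Qed.

End sublinear.

(** * Norming functionals over the real and the complex numbers *)

Definition norming_functionals (K : scalarFieldType) : Prop :=
  forall (E : normedModType K) (x : E),
    exists2 f : bounded_linear E K, `|f| <= 1 & `|x| <= `|f x|.

Lemma exists_bounded_linear (K : scalarFieldType) (E F : normedModType K)
    (g : E -> F) (c : K) : 0 <= c -> linear g ->
    (forall x, `|g x| <= c * `|x|) ->
  exists2 f : bounded_linear E F, f =1 g & `|f| <= c.
Proof.
move=> c0 g_lin gc.
have gP : g \in @bounded_linear_pred K E F.
  by apply/asboolP; split=> //; exists c.
exists (BoundedLinear gP) => //.
by have [_ _] := opnormP (BoundedLinear gP); apply.
Qed.

(** A linear functional f <= |.| satisfies |f| <= |.|, the norm being even. *)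
Lemma real_norming_functionals (R : realType) : norming_functionals R.
Proof.
move=> E x.
have norm_sub : sublinear (fun y : E => `|y|).
  split=> [y z|c y c0]; first exact: ler_normD.
  by rewrite normrZ ger0_norm.
have [f [f_lin f_le fx]] := hahn_banach_sublinear x norm_sub.
have f_norm y : `|f y| <= 1 * `|y|.
  rewrite mul1r ler_norml f_le andbT lerNl -normrN.
  have -> : - f y = f (- y); last exact: f_le.
  have f0 : f 0 = 0 by have := f_lin (-1) 0 0; rewrite scaler0 addr0; lra.
  by have := f_lin (-1) y 0; rewrite addr0 scaleN1r mulN1r f0 addr0.
have [g gf g1] := @exists_bounded_linear R E R f 1 ler01 f_lin f_norm.
by exists g => //; rewrite gf fx; exact: ler_norm.
Qed.

(** The real vector space underlying a complex one, under a name of its own so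
    that its scaling is not confused with the complex one. *)
Section realified.
Variables (R : realType) (E : lmodType R[i]).

Definition realified : Type := E.

HB.instance Definition _ := GRing.Zmodule.on realified.

Let realified_scale (c : R) (x : realified) : realified := (c%:C)%C *: (x : E).

Let realified_scaleA a b x :
  realified_scale a (realified_scale b x) = realified_scale (a * b) x.
Proof. by rewrite /realified_scale scalerA -rmorphM. Qed.

Let realified_scale1 : left_id 1 realified_scale.
Proof. by move=> x; rewrite /realified_scale rmorph1 scale1r. Qed.

Let realified_scaleDr : right_distributive realified_scale +%R.
Proof. by move=> c x y; rewrite /realified_scale scalerDr. Qed.

Let realified_scaleDl x : {morph realified_scale^~ x : a b / a + b}.
Proof. by move=> a b; rewrite /realified_scale rmorphD scalerDl. Qed.

HB.instance Definition _ := GRing.Zmodule_isLmodule.Build R realified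
  realified_scaleA realified_scale1 realified_scaleDr realified_scaleDl.

Lemma realified_scaleE (c : R) (x : realified) :
  c *: x = (c%:C)%C *: (x : E) :> E.
Proof. by []. Qed.

End realified.

(** For real-linear f, the unique complex-linear functional with real part f. *)
Definition complexified (R : realType) (E : lmodType R[i]) (f : E -> R)
    (x : E) : R[i] :=
  (f x +i* - f ('i%C *: x))%C.

Lemma complexified_linear (R : realType) (E : lmodType R[i]) (f : E -> R) :
  linear_for *%R (f : realified E -> R) ->
  linear_for *%R (complexified f).
Proof.
move=> f_lin.
have fD x y : f (x + y) = f x + f y.
  by have := f_lin 1 x y; rewrite realified_scaleE !scale1r mul1r.
have fZ c x : f ((c%:C)%C *: x) = c * f x.
  have := f_lin c x 0; rewrite realified_scaleE addr0 => ->.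
  have := fD 0 0; rewrite addr0 => f0; rewrite (_ : f 0 = 0) ?addr0 //.
  by move: f0; lra.
have f_scale (a b : R) x : f ((a +i* b)%C *: x) = a * f x + b * f ('i%C *: x).
  rewrite -!fZ -fD scalerA -scalerDl; congr (f (_ *: _)).
  by simpc.
move=> [a b] x y; rewrite /complexified.
have -> : 'i%C *: ((a +i* b)%C *: x + y) = ((- b) +i* a)%C *: x + 'i%C *: y.
  by rewrite scalerDr scalerA; congr (_ *: _ + _); simpc.
rewrite !fD (f_scale a b) (f_scale (- b) a); apply/eqP.
by rewrite eq_complex /=; apply/andP; split; apply/eqP; ring.
Qed.

(** Let f be a real functional with f <= |.| and f x = |x|, and g the complex
    one with real part f. The bound |g y| <= |y| holds because multiplying y by
    a complex number of modulus 1 makes g y real and nonnegative, hence equal to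
    a value of f. *)
Lemma complex_norming_functionals (R : realType) : norming_functionals R[i].
Proof.
move=> E x.
pose p (y : realified E) : R := complex.Re `|y : E|.
have pE (y : E) : `|y| = ((p y)%:C)%C.
  have := normr_ge0 y; rewrite /p; case: `|y| => a b.
  by rewrite lecE /= => /andP[/eqP->].
have p_sub : sublinear p.
  split=> [y z|c y c0]; rewrite -lecR ?rmorphD ?rmorphM /= -!pE.
    exact: ler_normD.
  by rewrite realified_scaleE normrZ ger0_norm // lecR.
have [f [f_lin f_le fx]] := @hahn_banach_sublinear R (realified E) p x p_sub.
pose g := complexified f.
have g_lin : linear_for *%R (g : E -> R[i]) by exact: complexified_linear.
have gZ c y : g (c *: y) = c * g y.
  have := g_lin c y 0; rewrite addr0 => ->.
  have : g 0 = - g 0 + g 0.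
    by have := g_lin (-1) 0 0; rewrite scaler0 addr0 mulN1r.
  by rewrite addNr => ->; rewrite addr0.
have Re_g y : complex.Re (g y) <= p y by exact: f_le.
have g_norm y : `|g y| <= 1 * `|y|.
  (* c is the rotation that sends g y to its modulus. *)
  rewrite mul1r; have [->|gy0] := eqVneq (g y) 0; first by rewrite normr0.
  pose c := `|g y| / g y.
  have c1 : `|c| = 1 by rewrite normrM normr_id normfV divff // normr_eq0.
  have := Re_g (c *: y); rewrite gZ /c divfK // -lecR -pE normrZ -/c c1 mul1r.
  by rewrite RRe_real ?normr_real.
pose C : scalarFieldType := R[i].
have [h hg h1] := @exists_bounded_linear C E C g 1 ler01 g_lin g_norm.
exists h => //; rewrite hg pE -fx -[f x]/(complex.Re (g x)).
by rewrite (le_trans _ (normc_ge_Re _)) // lecR; exact: ler_norm.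
Qed.

(** * The norm of a Banach operator ideal *)

Section operator_norm.
Variable K : scalarFieldType.

Lemma norm_bounded_linear_le (E F : normedModType K) (f : bounded_linear E F)
    x :
  `|f x| <= `|f| * `|x|.
Proof. by have [] := opnormP f. Qed.

Lemma exists_ray (E : normedModType K) (x : E) :
  exists2 f : bounded_linear K E, (forall a, f a = a *: x) & `|f| <= `|x|.
Proof.
apply: exists_bounded_linear => // [a b c|a]; last by rewrite normrZ mulrC.
by rewrite scalerDl scalerA.
Qed.

Section ideal_norm.
Variables (I : operator_class K) (nI : operator_class_norm K).
Hypothesis II : banach_operator_ideal I nI.

(** The composite of a |-> a x, T and g is multiplication by g (T x) on K, that
    is g (T x) times the identity of K, which has ideal norm 1. *)
Lemma ideal_norm_ge_pairing (E F : completeNormedModType K)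
    (T : bounded_linear E F) (g : bounded_linear F K) (x : E) :
  I T -> `|g (T x)| <= `|g| * nI T * `|x|.
Proof.
move=> IT; have [v vE v_le] := exists_ray x.
have gTv : comp_linear g (comp_linear T v) = g (T x) *: id_linear K.
  apply: bounded_linear_eq => a /=; rewrite vE !linearZ; exact: mulrC.
have := banach_operator_ideal_comp II g v IT.
have id_in := operator_ideal_id (banach_operator_ideal_ideal II).
rewrite gTv (banach_normZ (banach_operator_ideal_banach II K K)) //.
rewrite (banach_operator_ideal_id II) mulr1 => /le_trans; apply.
apply: ler_wpM2l => //; apply: mulr_ge0 => //.
exact: (banach_norm_ge0 (banach_operator_ideal_banach II E F)).
Qed.

(** The pairing bound, for a functional g that norms T x. *)
Lemma ideal_norm_ge_opnorm (E F : completeNormedModType K)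
    (T : bounded_linear E F) :
  norming_functionals K -> I T -> `|T| <= nI T.
Proof.
move=> K_norming IT; have nT0 : 0 <= nI T.
  exact: (banach_norm_ge0 (banach_operator_ideal_banach II E F)).
have [_ _] := opnormP T; apply=> // x; have [g g1 gT] := K_norming F (T x).
apply: le_trans gT _; apply: le_trans (ideal_norm_ge_pairing g x IT) _.
by apply: ler_wpM2r => //; exact: ler_piMl.
Qed.

End ideal_norm.
End operator_norm.

(** * Transposes *)

Section transpose.
Variables (K : scalarFieldType) (X1 X2 : pointedMetricType K).

Lemma two_lipschitz_second_difference_le (E : normedModType K)
    (T : two_lipschitz X1 X2 E) x1 x1' x2 x2' :
  `|second_difference T x1 x1' x2 x2'| <= `|T| * (mdist x1 x1' * mdist x2 x2').
Proof. by have [_ TP _] := BLipP T; exact: TP. Qed.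

Lemma second_difference_transpose (E : normedModType K)
    (T : two_lipschitz X1 X2 E) (f : bounded_linear E K) x1 x1' x2 x2' :
  second_difference (transpose T f) x1 x1' x2 x2' =
    f (second_difference T x1 x1' x2 x2').
Proof. by rewrite /second_difference linearD !linearB. Qed.

Lemma transpose_linear (E : normedModType K) :
  linear (@transpose K X1 X2 E).
Proof.
move=> a S T; apply: bounded_linear_eq => f; apply: two_lipschitz_eq => x1 x2.
exact: linearP.
Qed.

HB.instance Definition _ (E : normedModType K) :=
  GRing.isLinear.Build K (two_lipschitz X1 X2 E)
    (bounded_linear (bounded_linear E K) (two_lipschitz X1 X2 K)) *:%R
    (@transpose K X1 X2 E) (@transpose_linear E).

Lemma norm_transpose_le (E : normedModType K) (T : two_lipschitz X1 X2 E) :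
  `|transpose T| <= `|T|.
Proof.
have [_ _] := opnormP (transpose T); apply=> // f.
have [_ _] := BLipP (transpose T f); apply=> [|x1 x1' x2 x2'].
  by rewrite mulr_ge0.
rewrite second_difference_transpose [`|T| * _]mulrC -mulrA.
apply: le_trans (norm_bounded_linear_le _ _) _; apply: ler_wpM2l => //.
exact: two_lipschitz_second_difference_le.
Qed.

(** A functional that norms a second difference of T bounds it by the second
    difference of the scalar map T^t f at the same points. *)
Lemma norm_transpose (E : normedModType K) (T : two_lipschitz X1 X2 E) :
  norming_functionals K -> `|transpose T| = `|T|.
Proof.
move=> K_norming; apply/eqP; rewrite eq_le norm_transpose_le /=.
have [_ _] := BLipP T; apply=> // x1 x1' x2 x2'.
have [f f1 fT] := K_norming E (second_difference T x1 x1' x2 x2').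
apply: le_trans fT _.
rewrite -second_difference_transpose.
apply: le_trans (two_lipschitz_second_difference_le _ _ _ _ _) _.
apply: ler_wpM2r; first by rewrite mulr_ge0 // mdist_ge0.
apply: le_trans (norm_bounded_linear_le _ _) _.
exact: ler_piMr.
Qed.

End transpose.

(** * Transposes of composites and of elementary maps *)

Section precomposition.
Variable K : scalarFieldType.

Lemma LipP (X Y : pointedMetricType K) (f : lip0 X Y) :
  0 <= Lip f /\ forall x x', mdist (f x) (f x') <= Lip f * mdist x x'.
Proof.
have [c _ fc] := lip0_bounded f.
have [|||f0 fP _] := @least_boundP K (X * X)%type
  (fun p => mdist (f p.1) (f p.2)) (fun p => mdist p.1 p.2) _ _ c.
- by move=> p; exact: mdist_ge0.
- by move=> p; exact: mdist_ge0.
- by move=> p; exact: fc.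
by split=> // x x'; exact: (fP (x, x')).
Qed.

Lemma exists_pre_comp (Z W X1 X2 : pointedMetricType K) (E : normedModType K)
    (f1 : lip0 Z X1) (f2 : lip0 W X2) :
  exists2 P : bounded_linear (two_lipschitz X1 X2 E) (two_lipschitz Z W E),
    (forall T, P T = pre_comp T f1 f2) & `|P| <= Lip f1 * Lip f2.
Proof.
have [f10 f1P] := LipP f1; have [f20 f2P] := LipP f2.
apply: exists_bounded_linear => [|a S T|T]; first exact: mulr_ge0.
  exact: two_lipschitz_eq.
have [_ _] := BLipP (pre_comp T f1 f2); apply=> [|z z' w w'].
  by rewrite !mulr_ge0.
apply: le_trans
  (two_lipschitz_second_difference_le T (f1 z) (f1 z') (f2 w) (f2 w')) _.
rewrite [_ * `|T|]mulrC -mulrA; apply: ler_wpM2l => //.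
by rewrite mulrACA; apply: ler_pM => //; exact: mdist_ge0.
Qed.

Lemma exists_adjoint (E F : normedModType K) (u : bounded_linear E F) :
  exists2 v : bounded_linear (bounded_linear F K) (bounded_linear E K),
    (forall f, v f = comp_linear f u) & `|v| <= `|u|.
Proof.
apply: exists_bounded_linear => // [a f g|f].
  exact: bounded_linear_eq.
have [_ _] := opnormP (comp_linear f u); apply=> [|x]; first exact: mulr_ge0.
apply: le_trans (norm_bounded_linear_le f (u x)) _.
rewrite [`|u| * _]mulrC -mulrA; apply: ler_wpM2l => //.
exact: norm_bounded_linear_le.
Qed.

Lemma exists_evaluation (X1 X2 : pointedMetricType K) (E : normedModType K)
    x1 x2 :
  exists2 v : bounded_linear (two_lipschitz X1 X2 E) E,
    (forall T, v T = T x1 x2) & `|v| <= mdist x1 point * mdist x2 point.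
Proof.
apply: exists_bounded_linear => // [|T]; first by rewrite mulr_ge0 // mdist_ge0.
rewrite -(second_difference_point T) mulrC.
exact: two_lipschitz_second_difference_le.
Qed.

Lemma exists_bidual_point (E : normedModType K) (x : E) :
  exists2 v : bounded_linear (bounded_linear E K) K, (forall f, v f = f x) &
    `|v| <= `|x|.
Proof.
apply: exists_bounded_linear => // f; rewrite mulrC.
exact: norm_bounded_linear_le.
Qed.

Lemma transpose_comp (Z W X1 X2 : pointedMetricType K) (E F : normedModType K)
    (f1 : lip0 Z X1) (f2 : lip0 W X2) (T : two_lipschitz X1 X2 E)
    (u : bounded_linear E F) :
  exists P v,
    [/\ transpose (post_comp u (pre_comp T f1 f2)) =
          comp_linear P (comp_linear (transpose T) v),
        `|P| <= Lip f1 * Lip f2 & `|v| <= `|u|].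
Proof.
have [P PE P_le] := exists_pre_comp K f1 f2.
have [v vE v_le] := exists_adjoint u.
exists P, v; split=> //; apply: bounded_linear_eq => f /=.
by rewrite PE vE; exact: two_lipschitz_eq.
Qed.

(** On a functional f the transpose is f e times the scalar map f1 f2: first
    evaluate f at e, then scale f1 f2. *)
Lemma transpose_rank_one (X1 X2 : pointedMetricType K) (E : normedModType K)
    (f1 : lip0 X1 K) (f2 : lip0 X2 K) (e : E) :
  exists w v, transpose (rank_one f1 f2 e) =
    comp_linear w (comp_linear (id_linear K) v).
Proof.
have [w wE _] := exists_ray (rank_one f1 f2 (1 : K)).
have [v vE _] := exists_bidual_point e.
exists w, v; apply: bounded_linear_eq => f; rewrite /= wE vE.
apply: two_lipschitz_eq => x1 x2.
rewrite [LHS]linearZ.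
transitivity (f e * (f1 x1 * f2 x2 * 1)) => //; rewrite mulr1; exact: mulrC.
Qed.

Lemma norm_mul_two_lipschitz_le1 : `|mul_two_lipschitz K| <= 1.
Proof.
have [_ _] := BLipP (mul_two_lipschitz K); apply=> // a a' b b'; rewrite mul1r.
have -> : second_difference (mul_two_lipschitz K) a a' b b' =
  (a' - a) * (b' - b) by rewrite /second_difference /=; ring.
by rewrite normrM.
Qed.

(** By linearity f (a b) = f 1 * (a b): evaluate f at 1, then scale the
    product. *)
Lemma transpose_mul_factor : exists w v,
  [/\ transpose (mul_two_lipschitz K) =
        comp_linear w (comp_linear (id_linear K) v), `|w| <= 1 & `|v| <= 1].
Proof.
have [w wE w1] := exists_ray (mul_two_lipschitz K).
have [v vE v1] := exists_bidual_point (1 : K).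
exists w, v; split.
- apply: bounded_linear_eq => f; rewrite /= wE vE.
  apply: two_lipschitz_eq => a b.
  have f_ab : f (a * b) = a * b * f 1 by rewrite -{1}[a * b]mulr1 [LHS]linearZ.
  by transitivity (f (a * b)) => //; rewrite f_ab mulrC.
- exact: le_trans w1 norm_mul_two_lipschitz_le1.
- by rewrite normr1 in v1.
Qed.

(** A scalar a gives the functional x |-> a x, which the transpose of the
    product sends to (x, y) |-> a x y, a map of value a at (1, 1). *)
Lemma id_factor_transpose_mul : exists w v,
  [/\ id_linear K =
        comp_linear w (comp_linear (transpose (mul_two_lipschitz K)) v),
      `|w| <= 1 & `|v| <= 1].
Proof.
have [w wE w1] := @exists_evaluation K K K 1 1.
have [v vE v1] := exists_ray (id_linear K).
exists w, v; split.
- apply: bounded_linear_eq => a; rewrite /= wE vE /=.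
  by transitivity (a * (1 * 1)) => //; rewrite !mulr1.
- have d1 : mdist (1 : K) point = 1.
    by transitivity (`|0 - 1 : K|) => //; rewrite sub0r normrN1.
  by rewrite d1 mulr1 in w1.
- apply: le_trans v1 _; have [_ _] := opnormP (id_linear K).
  by apply=> // x; rewrite mul1r.
Qed.

End precomposition.

(** * The two-Lipschitz dual of a Banach operator ideal *)

Section two_lipschitz_dual.
Variables (K : scalarFieldType) (I : operator_class K).
Variable nI : operator_class_norm K.
Hypothesis II : banach_operator_ideal I nI.

Let ideal_in := banach_operator_ideal_ideal II.
Let banach_in := banach_operator_ideal_banach II.

Lemma BLip_dual_subspace X1 X2 (E : completeNormedModType K) :
  is_subspace (@BLip_dual K I X1 X2 E).
Proof.
have [I0 I_lin] := operator_ideal_subspace ideal_in (bounded_linear E K)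
  (two_lipschitz X1 X2 K).
split=> [|a S T IS IT]; rewrite /BLip_dual /=.
  by rewrite linear0.
by rewrite linearP; exact: I_lin.
Qed.

Lemma BLip_dual_ideal : two_lipschitz_ideal (BLip_dual I).
Proof.
split.
- exact: BLip_dual_subspace.
- move=> X1 X2 E f1 f2 e; rewrite /BLip_dual /=.
  have [w [v ->]] := transpose_rank_one f1 f2 e.
  exact: (operator_ideal_comp ideal_in _ _ (operator_ideal_id ideal_in)).
- move=> Z W X1 X2 E F f1 f2 T u IT; rewrite /BLip_dual /=.
  have [P [v [-> _ _]]] := transpose_comp f1 f2 T u.
  exact: (operator_ideal_comp ideal_in).
Qed.

Lemma comp_norm_le (E0 E F F0 : completeNormedModType K)
    (w : bounded_linear F F0) (T : bounded_linear E F) (v : bounded_linear E0 E)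
    (c d : K) : I T -> `|w| <= c -> `|v| <= d ->
  nI (comp_linear w (comp_linear T v)) <= c * nI T * d.
Proof.
move=> IT wc vd; apply: le_trans (banach_operator_ideal_comp II w v IT) _.
have nT0 : 0 <= nI T by exact: (banach_norm_ge0 (banach_in E F)).
by apply: ler_pM => //; [exact: mulr_ge0|exact: ler_wpM2r].
Qed.

Lemma BLip_dual_norm_id : BLip_dual_norm nI (mul_two_lipschitz K) = 1.
Proof.
have id_in := operator_ideal_id ideal_in.
have mul_in : BLip_dual I (mul_two_lipschitz K).
  rewrite /BLip_dual /=; have [w [v [-> _ _]]] := transpose_mul_factor K.
  exact: (operator_ideal_comp ideal_in).
apply/eqP; rewrite /BLip_dual_norm eq_le; apply/andP; split.
  have [w [v [-> w1 v1]]] := transpose_mul_factor K.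
  apply: le_trans (comp_norm_le id_in w1 v1) _.
  by rewrite (banach_operator_ideal_id II) !mulr1.
have [w [v [id_eq w1 v1]]] := id_factor_transpose_mul K.
rewrite -(banach_operator_ideal_id II) id_eq.
by apply: le_trans (comp_norm_le mul_in w1 v1) _; rewrite mul1r mulr1.
Qed.

Hypothesis K_norming : norming_functionals K.

Lemma BLip_le_dual_norm X1 X2 (E : completeNormedModType K)
    (T : two_lipschitz X1 X2 E) :
  BLip_dual I T -> BLip T <= BLip_dual_norm nI T.
Proof.
move=> IT; rewrite -[BLip T]/`|T| -(norm_transpose T K_norming).
exact: (ideal_norm_ge_opnorm II K_norming).
Qed.

(** The BLip-limit T and the ideal limit S of the transposes are compared in
    operator norm, where transposition is continuous and which both other norms
    dominate. *)
Lemma BLip_dual_complete X1 X2 (E : completeNormedModType K)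
    (u : nat -> two_lipschitz X1 X2 E) :
    (forall k, BLip_dual I (u k)) ->
    (forall e, 0 < e -> exists N, forall p q, (N <= p)%N -> (N <= q)%N ->
      BLip_dual_norm nI (u p - u q) < e) ->
  exists2 T, BLip_dual I T &
    forall e, 0 < e -> exists N, forall p, (N <= p)%N ->
      BLip_dual_norm nI (u p - T) < e.
Proof.
move=> Iu u_cauchy.
have [_ I_lin] := operator_ideal_subspace ideal_in (bounded_linear E K)
  (two_lipschitz X1 X2 K).
have IB (A B : bounded_linear (bounded_linear E K) (two_lipschitz X1 X2 K)) :
    I A -> I B -> I (A - B).
  by move=> IA IB; rewrite addrC -scaleN1r; exact: I_lin.
have [|S IS uS] := banach_complete (banach_in _ _)
  (u := fun k => transpose (u k)) Iu.
  move=> e /u_cauchy[N uN]; exists N => p q Np Nq; rewrite -linearB.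
  exact: uN.
have u_cvg : cvg (u @ \oo).
  apply: cauchy_cvg; apply/cauchyP => e /u_cauchy[N uN].
  exists (u N); exists N => // q /= Nq; rewrite -ball_normE /=.
  apply: le_lt_trans (uN N q (leqnn N) Nq); apply: BLip_le_dual_norm.
  by rewrite /BLip_dual /= linearB; apply: IB; exact: Iu.
move/cvg_ex: u_cvg => [T uT].
suff ST : S = transpose T.
  exists T; first by rewrite /BLip_dual /= -ST.
  move=> e /uS[N uN]; exists N => p Np.
  rewrite /BLip_dual_norm [transpose _]linearB /= -ST.
  exact: uN.
apply: (@norm_cvg_unique _ _ ((fun k => transpose (u k)) @ \oo)).
  apply/cvgrPdist_lt => e /uS[N uN]; exists N => // p /= Np.
  rewrite distrC; apply: le_lt_trans (uN p Np).
  apply: (ideal_norm_ge_opnorm II K_norming).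
  by apply: IB; [exact: Iu|exact: IS].
move/cvgrPdist_lt: uT => uT; apply/cvgrPdist_lt => e /uT.
apply: filterS => p; rewrite -linearB; apply: le_lt_trans.
exact: norm_transpose_le.
Qed.

Lemma BLip_dual_banach X1 X2 (E : completeNormedModType K) :
  is_banach_for (@BLip_dual K I X1 X2 E) (@BLip_dual_norm K nI X1 X2 E).
Proof.
split.
- by move=> T IT; exact: (banach_norm_ge0 (banach_in _ _)).
- move=> T IT nT0; apply: BLip0_eq0; apply/eqP; rewrite eq_le.
  by rewrite -{1}nT0 BLip_le_dual_norm //=; have [] := BLipP T.
- move=> a T IT; rewrite /BLip_dual_norm linearZ.
  exact: (banach_normZ (banach_in _ _)).
- move=> S T IS IT; rewrite /BLip_dual_norm linearD.
  exact: (banach_normD (banach_in _ _)).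
- exact: BLip_dual_complete.
Qed.

Lemma BLip_dual_banach_ideal :
  banach_two_lipschitz_ideal (BLip_dual I) (BLip_dual_norm nI).
Proof.
split.
- exact: BLip_dual_ideal.
- exact: BLip_dual_banach.
- exact: BLip_le_dual_norm.
- exact: BLip_dual_norm_id.
- move=> Z W X1 X2 E F f1 f2 T u IT; rewrite /BLip_dual_norm.
  have [P [v [-> P_le v_le]]] := transpose_comp f1 f2 T u.
  apply: le_trans (comp_norm_le IT P_le v_le) _.
  by rewrite le_eqVlt; apply/orP; left; apply/eqP; ring.
Qed.

End two_lipschitz_dual.

Theorem corollary4p4 (R : realType) (s : scalar_kind)
    (I : operator_class (scalar_field R s))
    (nI : operator_class_norm (scalar_field R s)) :
  banach_operator_ideal I nI ->
  banach_two_lipschitz_ideal (BLip_dual I) (BLip_dual_norm nI).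
Proof.
move=> II; apply: BLip_dual_banach_ideal => //; case: s I nI II => _ _ _.
  exact: real_norming_functionals.
exact: complex_norming_functionals.
Qed.
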